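(* Let $p$ be a prime, $n\ge 1$, let $C\subseteq \mathbf{F}_p^{2n}$ be a linear space with $C\subseteq C^\perp$, let $I\subseteq\{1,\dots,n\}$ with complement $\overline{I}$, and let $D$ be any linear subspace of $C$. Consider the conditions (A) $C\cap\mathbf{F}_p^I=C^\perp\cap\mathbf{F}_p^I$; (B) $C=D+(C\cap\mathbf{F}_p^{\overline{I}})$; (E) $C\cap\mathbf{F}_p^I=D^\perp\cap\mathbf{F}_p^I$. Then (E) implies both (A) and (B). Conversely, (A) and (B) together imply (E), which means that measurements of the observables defined by $D$ can correct erasures at $I$ on codewords in $Q(C)$ when both (A) and (B) hold.
   Context: $\mathbf{F}_p$ is the field with $p$ elements. Vectors of $\mathbf{F}_p^{2n}$ are written $(a_1,\dots,a_n|b_1,\dots,b_n)$. The symplectic inner product is $\langle (a|b),(a'|b')\rangle=\sum_{i=1}^n (a_ib'_i-a'_ib_i)$ and $C^\perp$ is the orthogonal space with respect to it. For $J\subseteq\{1,\dots,n\}$, $\mathbf{F}_p^J=\{(a|b)\in\mathbf{F}_p^{2n}: a_i=b_i=0 \text{ if } i\notin J\}$. Let $\mathcal{H}_p$ be a $p$-dimensional complex space with orthonormal basis $|0\rangle,\dots,|p-1\rangle$, $X|i\rangle=|i+1 \bmod p\rangle$, $Z|i\rangle=\exp(2\pi\sqrt{-1}/p)^i|i\rangle$, and $M(a|b)=X^{a_1}Z^{b_1}\otimes\cdots\otimes X^{a_n}Z^{b_n}$ acting on $\mathcal{H}_p^{\otimes n}$. For $C\subseteq C^\perp$, the group $S$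 generated by $\{M(\vec{x}):\vec{x}\in C\}$ is commutative; fix a common eigenvector of $S$ and let $\eta(U)$ be its eigenvalue for $U\in S$ (not required to be $+1$). The stabilizer code is $Q(C)=\{|\psi\rangle\in\mathcal{H}_p^{\otimes n}: U|\psi\rangle=\eta(U)|\psi\rangle \text{ for all } U\in S\}$. Measurement and correction. For $\vec{x}\in C$, the observable defined by $\vec{x}$ is one whose eigenspaces are those of $M(\vec{x})$. For an erasure vector $\vec{e}\in\mathbf{F}_p^I$ and a codeword $|\psi\rangle\in Q(C)$, measuring it on $M(\vec{e})|\psi\rangle$ gives a deterministic outcome equivalent to the value $\langle\vec{x},\vec{e}\rangle\in\mathbf{F}_p$. Measuring $D$ means measuring the observables of a basis $\vec{x}_1,\dots,\vec{x}_\ell$ of $D$, giving the syndrome $s(\vec{e})=(\langle \vec{x}_i,\vec{e}\rangle)_{i=1}^{\ell}$. These measurements ''can correct erasures at $I$ on codewords in $Q(C)$'' if for each syndrome $s\in\mathbf{F}_p^\ell$ there is a unitary $U_s$ such that for all $\vec{e}\in\mathbf{F}_p^I$ with $s(\vec{e})=s$ and all $|\psi\rangle\in Q(C)$, the vector $U_sM(\vec{e})|\psi\rangle$ equals $|\psi\rangle$ up to a scalar phase; equivalently, the syndrome $s(\vec{e})$ determines $\vec{e}\in\mathbf{F}_p^I$ uniquely modulo $C$. *)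

(* Defs.v *)
From HB Require Import structures.
From mathcomp Require Import all_boot all_order all_algebra.
From mathcomp Require Import complex.
From mathcomp Require Import reals trigo.

Set Implicit Arguments.
Unset Strict Implicit.
Unset Printing Implicit Defensive.

Import Order.TTheory GRing.Theory Num.Theory.

Local Open Scope ring_scope.
Local Open Scope complex_scope.

(* F_p^{2n}: the vector (a_1,...,a_n|b_1,...,b_n) is the concatenation of a and
   b.  'F_p is the field with p elements only when p is prime. *)
Notation vec2 p n := 'rV['F_p]_(n + n).

Section SymplecticSpace.
Variables p n : nat.

Implicit Types (x y : vec2 p n) (C : {vspace vec2 p n}) (J : {set 'I_n}).

Definition apart x (i : 'I_n) : 'F_p := x 0 (lshift n i).
Definition bpart x (i : 'I_n) : 'F_p := x 0 (rshift n i).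

Definition symp x y : 'F_p :=
  \sum_(i < n) (apart x i * bpart y i - apart y i * bpart x i).

(* In the next two definitions the predicate is already closed under linear
   combinations, so taking the span adds nothing: see [mem_perp], [mem_coordsp]. *)
Definition perp C : {vspace vec2 p n} :=
  span (enum [pred y : vec2 p n | [forall x : vec2 p n, (x \in C) ==> (symp x y == 0)]]).

Definition coordsp J : {vspace vec2 p n} :=
  span (enum [pred x : vec2 p n |
     [forall i : 'I_n, (i \notin J) ==> (apart x i == 0) && (bpart x i == 0)]]).

Lemma mem_span_enum (P : pred (vec2 p n)) :
  P 0 -> (forall (c : 'F_p) u v, P u -> P v -> P (c *: u + v)) ->
  forall v : vec2 p n, (v \in <<enum P>>%VS) = P v.
Proof.
move=> P0 PD v; apply/idP/idP => [|Pv]; last first.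
  by apply: memv_span; rewrite mem_enum.
move/(@coord_span _ _ _ (in_tuple (enum P))) ->.
elim/big_rec: _ => // i u _ Pu; apply: PD => //.
have : (enum P)`_i \in enum P by apply: mem_nth; apply: ltn_ord.
by rewrite mem_enum.
Qed.

Lemma apart_lin (c : 'F_p) x y i : apart (c *: x + y) i = c * apart x i + apart y i.
Proof. by rewrite /apart !mxE. Qed.

Lemma bpart_lin (c : 'F_p) x y i : bpart (c *: x + y) i = c * bpart x i + bpart y i.
Proof. by rewrite /bpart !mxE. Qed.

Lemma symp_linr (c : 'F_p) x y z : symp x (c *: y + z) = c * symp x y + symp x z.
Proof.
rewrite /symp mulr_sumr -big_split /=; apply: eq_bigr => i _.
rewrite apart_lin bpart_lin mulrDr mulrDl opprD mulrBr addrACA.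
by rewrite mulrCA -mulrA.
Qed.

Lemma mem_perp C y : reflect (forall x, x \in C -> symp x y = 0) (y \in perp C).
Proof.
rewrite /perp mem_span_enum => [|/=|/= c u v /forallP Hu /forallP Hv].
- apply: (iffP forallP) => H x; first by move=> Cx; apply/eqP/(implyP (H x)).
  by apply/implyP => /H ->.
- apply/forallP => x; apply/implyP => _; rewrite /symp big1 // => i _.
  by rewrite /apart /bpart !mxE mulr0 mul0r subrr.
- apply/forallP => x; apply/implyP => Cx; rewrite symp_linr.
  by rewrite (eqP (implyP (Hu x) Cx)) (eqP (implyP (Hv x) Cx)) mulr0 addr0.
Qed.

Lemma mem_coordsp J x :
  reflect (forall i, i \notin J -> apart x i = 0 /\ bpart x i = 0)
          (x \in coordsp J).
Proof.
rewrite /coordsp mem_span_enum => [|/=|/= c u v /forallP Hu /forallP Hv].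
- apply: (iffP forallP) => H i; last by apply/implyP => /H[-> ->]; rewrite eqxx.
  by move=> Ji; have /andP[/eqP ? /eqP ?] := implyP (H i) Ji.
- by apply/forallP => i; rewrite /apart /bpart !mxE eqxx implybT.
- apply/forallP => i; apply/implyP => Ji; rewrite apart_lin bpart_lin.
  have /andP[/eqP-> /eqP->] := implyP (Hu i) Ji.
  have /andP[/eqP-> /eqP->] := implyP (Hv i) Ji.
  by rewrite mulr0 addr0 eqxx.
Qed.

End SymplecticSpace.

(* H_p^{(x) n} has the orthonormal basis |i_1> (x) ... (x) |i_n>, which is
   identified with the functions 'I_n -> 'I_p, themselves numbered by
   [enum_val]. *)
Notation qdim p n := #|{ffun 'I_n -> 'I_p}|.
Notation qstate R p n := 'cV[R[i]]_(qdim p n).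
Notation qop R p n := 'M[R[i]]_(qdim p n).

Section StabilizerCodes.
Variables (R : realType) (p n : nat).

(* exp(2 pi sqrt(-1) / p) *)
Definition omega : R[i] :=
  cos (pi *+ 2 / p%:R) +i* sin (pi *+ 2 / p%:R).

(* Column i of a matrix is the image of the basis vector |i>. *)
Definition pauliX : 'M[R[i]]_p :=
  \matrix_(j, i) (j == (i.+1 %% p)%N :> nat)%:R.

Definition pauliZ : 'M[R[i]]_p := diag_mx (\row_i omega ^+ i).

Definition tensor_mx (A : 'I_n -> 'M[R[i]]_p) : qop R p n :=
  \matrix_(j, i) \prod_(k < n)
    A k ((enum_val j : {ffun 'I_n -> 'I_p}) k) ((enum_val i : {ffun 'I_n -> 'I_p}) k).

Definition errM (x : vec2 p n) : qop R p n :=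
  tensor_mx (fun k => pauliX ^+ apart x k *m pauliZ ^+ bpart x k).

Implicit Types (C D : {vspace vec2 p n}) (x e : vec2 p n) (I : {set 'I_n}).

Inductive stab_group C : qop R p n -> Prop :=
| stab_gen x of x \in C : stab_group C (errM x)
| stab_one : stab_group C 1%:M
| stab_mul U V of stab_group C U & stab_group C V : stab_group C (U *m V)
| stab_inv U of stab_group C U : stab_group C (invmx U).

Definition stab_eigenvector C (eta : qop R p n -> R[i]) (phi : qstate R p n) : Prop :=
  phi != 0 /\ forall U : qop R p n, stab_group C U -> U *m phi = eta U *: phi.

Definition stabilizer_code C (eta : qop R p n -> R[i]) (psi : qstate R p n) : Prop :=
  forall U : qop R p n, stab_group C U -> U *m psi = eta U *: psi.

Definition syndrome (l : nat) (xs : l.-tuple (vec2 p n)) e : 'rV['F_p]_l :=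
  \row_(i < l) symp (tnth xs i) e.

(* That the syndrome is what the measurements yield is [measurement_outcome]. *)
Definition can_correct_with (l : nat) (xs : l.-tuple (vec2 p n)) I
    (Q : qstate R p n -> Prop) : Prop :=
  forall s : 'rV['F_p]_l, exists U : qop R p n, U \is unitarymx /\
    forall e, e \in coordsp p I -> syndrome xs e = s ->
    forall psi : qstate R p n, Q psi ->
    exists2 c : R[i], `|c| = 1 & U *m (errM e *m psi) = c *: psi.

Definition can_correct D I (Q : qstate R p n -> Prop) : Prop :=
  forall (l : nat) (xs : l.-tuple (vec2 p n)),
    basis_of D xs -> can_correct_with xs I Q.

Lemma omegaX k :
  omega ^+ k = cos (pi *+ 2 / p%:R *+ k) +i* sin (pi *+ 2 / p%:R *+ k).
Proof.
elim: k => [|k IH]; first by rewrite expr0 mulr0n cos0 sin0.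
rewrite exprS IH [_ *+ k.+1]mulrS cosD sinD /omega; set t := _ / _.
by apply/eqP; rewrite eq_complex /= eqxx addrC eqxx.
Qed.

Lemma omegaXp : (0 < p)%N -> omega ^+ p = 1.
Proof.
move=> p0; rewrite omegaX -mulr_natr divfK ?pnatr_eq0 -?lt0n //.
by rewrite cos2pi sin2pi.
Qed.

Lemma omega_mod k : (0 < p)%N -> omega ^+ (k %% p)%N = omega ^+ k.
Proof.
by move=> p0; rewrite {2}(divn_eq k p) exprD mulnC exprM omegaXp // expr1n mul1r.
Qed.

Lemma pauliZX : (0 < p)%N -> pauliZ *m pauliX = omega *: (pauliX *m pauliZ).
Proof.
move=> p0; apply/matrixP => j i; rewrite mul_diag_mx mul_mx_diag !mxE.
case: eqP => [->|_]; last by rewrite !(mul0r, mulr0).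
by rewrite mulr1 mul1r omega_mod // exprS.
Qed.

Lemma pauliZX_expl b : (0 < p)%N ->
  pauliZ ^+ b *m pauliX = omega ^+ b *: (pauliX *m pauliZ ^+ b).
Proof.
move=> p0; elim: b => [|b IH].
  by rewrite !expr0 mul1mx mulmx1 scale1r.
rewrite exprS -mulmxA IH -scalemxAr mulmxA pauliZX // -scalemxAl scalerA.
by rewrite -mulmxA -exprSr.
Qed.

Lemma pauliZX_exp a b : (0 < p)%N ->
  pauliZ ^+ b *m pauliX ^+ a =
  omega ^+ (a * b)%N *: (pauliX ^+ a *m pauliZ ^+ b).
Proof.
move=> p0; elim: a => [|a IH].
  by rewrite mul0n !expr0 mul1mx mulmx1 scale1r.
rewrite exprS mulmxA pauliZX_expl // -scalemxAl -mulmxA IH -scalemxAr scalerA.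
by rewrite -exprD -mulSn mulmxA.
Qed.

Lemma tensor_mx_mul (A B : 'I_n -> 'M[R[i]]_p) :
  tensor_mx A *m tensor_mx B = tensor_mx (fun k => A k *m B k).
Proof.
apply/matrixP => i j; rewrite !mxE.
under [RHS]eq_bigr do rewrite mxE.
rewrite bigA_distr_bigA /= (reindex (@enum_val {ffun 'I_n -> 'I_p} predT)) /=.
  by apply: eq_bigr => k _; rewrite !mxE big_split.
exact/onW_bij/enum_val_bij.
Qed.

Lemma tensor_mx_scale (c : 'I_n -> R[i]) (A : 'I_n -> 'M[R[i]]_p) :
  tensor_mx (fun k => c k *: A k) = (\prod_k c k) *: tensor_mx A.
Proof.
by apply/matrixP => i j; rewrite !mxE -big_split; apply: eq_bigr => k _; rewrite mxE.
Qed.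

Lemma eq_tensor_mx (A B : 'I_n -> 'M[R[i]]_p) :
  A =1 B -> tensor_mx A = tensor_mx B.
Proof. by move=> e; apply/matrixP => i j; rewrite !mxE; apply: eq_bigr => k _; rewrite e. Qed.

Definition chi (z : 'F_p) : R[i] := omega ^+ z.

Hypothesis p_pr : prime p.

Lemma chi_nat k : chi k%:R = omega ^+ k.
Proof. by rewrite /chi val_Fp_nat // omega_mod // prime_gt0. Qed.

Lemma chiD : {morph chi : x y / x + y >-> x * y}.
Proof.
by move=> x y; rewrite -(natr_Zp x) -(natr_Zp y) -natrD !chi_nat exprD.
Qed.

Lemma chi0 : chi 0 = 1. Proof. by rewrite /chi expr0. Qed.

Lemma chiM (x y : 'F_p) : chi (x * y) = omega ^+ (x * y)%N.
Proof. by rewrite -{1}(natr_Zp x) -{1}(natr_Zp y) -natrM chi_nat. Qed.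

Lemma chiN (z : 'F_p) : chi (- z) = (chi z)^-1.
Proof.
have E : chi z * chi (- z) = 1 by rewrite -chiD subrr chi0.
have nz : chi z != 0 by apply: contra_eqN E => /eqP->; rewrite mul0r eq_sym oner_eq0.
by apply: (mulfI nz); rewrite E divff.
Qed.

Lemma errM_mul x y :
  errM x *m errM y =
  (\prod_k chi (apart y k * bpart x k)) *: tensor_mx (fun k =>
     pauliX ^+ (apart x k + apart y k)%N *m pauliZ ^+ (bpart x k + bpart y k)%N).
Proof.
rewrite /errM tensor_mx_mul -tensor_mx_scale; apply: eq_tensor_mx => k.
rewrite -mulmxA [pauliZ ^+ _ *m (_ *m _)]mulmxA pauliZX_exp ?prime_gt0 //.
rewrite -!scalemxAl -!scalemxAr chiM !exprD; congr (_ *: _).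
by rewrite !mulmxA.
Qed.

Lemma errM_comm x y : errM x *m errM y = chi (- symp x y) *: (errM y *m errM x).
Proof.
rewrite !errM_mul scalerA; congr (_ *: _); last first.
  by apply: eq_tensor_mx => k; rewrite addnC [X in pauliZ ^+ X]addnC.
rewrite /symp -sumrN (big_morph chi chiD chi0) -big_split /=.
by apply: eq_bigr => k _; rewrite -chiD opprB subrK.
Qed.

Lemma measurement_outcome C eta x e psi :
  x \in C -> stabilizer_code C eta psi ->
  errM x *m (errM e *m psi) =
  (eta (errM x) * (omega ^+ symp x e)^-1) *: (errM e *m psi).
Proof.
move=> Cx Qpsi; rewrite mulmxA errM_comm -scalemxAl -mulmxA.
by rewrite (Qpsi _ (stab_gen Cx)) -scalemxAr scalerA chiN mulrC.
Qed.

End StabilizerCodes.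

(* Main.v *)
(* The symplectic form is nondegenerate and the orthogonal space of F_p^I is
   F_p^J with J the complement of I, so the orthogonal space of
   D + (C :&: F_p^J) is D^perp :&: (C^perp + F_p^I).  Under (E) this is
   contained in C^perp, which is (B).
   For the correction, two errors in F_p^I with the same syndrome differ by an
   element of D^perp :&: F_p^I, which (E) puts in C; hence they act alike on the
   code up to a phase, and the inverse of either one corrects both. *)
From HB Require Import structures.
Require Import Defs.
From mathcomp Require Import all_boot all_order all_algebra.
From mathcomp Require Import complex.
From mathcomp Require Import reals.
From mathcomp Require Import boolp ring sesquilinear spectral.

Import GRing.Theory Num.Theory.

Local Open Scope ring_scope.
Local Open Scope complex_scope.
Local Open Scope sesquilinear_scope.

(** * Orthogonality for the symplectic form *)

Section SymplecticDuality.
Variables p n : nat.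
Implicit Types (x y z : vec2 p n) (C D U V : {vspace vec2 p n}) (I J : {set 'I_n}).

Lemma sympC x y : symp x y = - symp y x.
Proof. by rewrite /symp -sumrN; apply: eq_bigr => i _; rewrite opprB. Qed.

Lemma sympDr x y z : symp x (y + z) = symp x y + symp x z.
Proof. by rewrite -{1}[y]scale1r symp_linr mul1r. Qed.

Lemma symp0r x : symp x 0 = 0.
Proof. by apply: (addrI (symp x 0)); rewrite -sympDr !addr0. Qed.

Lemma sympNr x y : symp x (- y) = - symp x y.
Proof. by apply: (addrI (symp x y)); rewrite -sympDr !subrr symp0r. Qed.

Lemma symp_sumr x (J : finType) (f : J -> vec2 p n) (c : J -> 'F_p) :
  symp x (\sum_j c j *: f j) = \sum_j c j * symp x (f j).
Proof.
by elim/big_rec2: _ => [|j a b _ <-]; rewrite ?symp0r ?symp_linr.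
Qed.

Lemma perpS {U V} : (U <= V)%VS -> (perp V <= perp U)%VS.
Proof.
move=> sUV; apply/subvP => y /mem_perp Vy; apply/mem_perp => x Ux.
exact/Vy/(subvP sUV).
Qed.

(** Nondegeneracy: the coordinates of [y] are the values of [f] on the unit vectors. *)
Lemma linear_form_symp (f : {scalar vec2 p n}) :
  exists y, forall x, f x = symp x y.
Proof.
(* The form pairs each half of [x] with the opposite half of [y], hence the swap. The sign cancels
   the minus in front of [apart y i * bpart x i]. *)
exists (row_mx (\row_i - f (delta_mx 0 (rshift n i)))
               (\row_i f (delta_mx 0 (lshift n i)))) => x.
rewrite {1}(row_sum_delta x) linear_sum big_split_ord /= /symp big_split /=.
congr (_ + _); apply: eq_bigr => i _; rewrite linearZ /= /apart /bpart.
  by rewrite row_mxEr mxE.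
by rewrite row_mxEl mxE mulNr opprK mulrC.
Qed.

(* A vector outside U differs from its projection to U in some coordinate;
   that coordinate of the difference is a linear form vanishing on U. *)
Lemma perpK U : perp (perp U) = U.
Proof.
apply/eqP; rewrite eqEsubv; apply/andP; split; apply/subvP => v.
  move/mem_perp=> Uv.
  suff -> : v = projv U v by apply: memv_proj.
  apply/rowP => j; apply/eqP; rewrite -subr_eq0; apply/eqP.
  pose g := fun x : vec2 p n => x 0 j - projv U x 0 j.
  have g_lin : scalar g by move=> c x y; rewrite /g linearP !mxE; ring.
  pose gL := GRing.isLinear.Build _ _ _ _ g g_lin.
  pose gl : {scalar vec2 p n} := HB.pack g gL.
  have [y gy] := linear_form_symp gl.
  rewrite -[LHS]/(gl v) gy sympC Uv ?oppr0 //.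
  by apply/mem_perp => x Ux; rewrite -gy /= /g projv_id ?subrr.
by move=> Uv; apply/mem_perp => y /mem_perp Uy; rewrite sympC Uy ?oppr0.
Qed.

Lemma mem_coordsp_perp {J x y} :
  x \in coordsp p (~: J) -> y \in coordsp p J -> symp x y = 0.
Proof.
move=> /mem_coordsp xJ /mem_coordsp yJ; rewrite /symp big1 // => i _.
have [Ji|/yJ[-> ->]] := boolP (i \in J); last by rewrite mulr0 mul0r subrr.
by have [|-> ->] := xJ i; rewrite ?inE ?Ji // mul0r mulr0 subrr.
Qed.

Lemma perp_coordsp J : perp (coordsp p J) = coordsp p (~: J).
Proof.
apply/eqP; rewrite eqEsubv; apply/andP; split; apply/subvP => y yJ; last first.
  apply/mem_perp => x xJ.
  by apply: (@mem_coordsp_perp (~: J)); rewrite ?setCK.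
move/mem_perp: yJ => yJ; apply/mem_coordsp => i; rewrite inE negbK => Ji.
have delta_mem (k : 'I_(n + n)) : k = lshift n i \/ k = rshift n i ->
    delta_mx 0 k \in coordsp p J.
  move=> ki; apply/mem_coordsp => m Jm.
  have /negPf im : m != i by apply: contraNneq Jm => ->.
  by case: ki => ->; rewrite /apart /bpart !mxE /= ?eq_lrshift ?eq_rlshift
    ?(inj_eq (@lshift_inj _ _)) ?(inj_eq (@rshift_inj _ _)) ?im.
(* Pairing with the two unit vectors at a position of [J] reads off both coordinates of [y] there,
   so they vanish. *)
have symp_delta m : symp (delta_mx 0 (lshift n m)) y = bpart y m
                /\ symp (delta_mx 0 (rshift n m)) y = - apart y m.
  rewrite /symp; split; rewrite (bigD1 m) //= big1 ?addr0 => [|k km];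
    rewrite /apart /bpart !mxE /= ?eqxx ?eq_lrshift ?eq_rlshift
     ?(inj_eq (@lshift_inj _ _)) ?(inj_eq (@rshift_inj _ _)) ?(negbTE km);
    by rewrite ?mulr0 ?mul0r ?mulr1 ?mul1r ?subr0 ?sub0r ?oppr0.
have [dl dr] := symp_delta i.
split; last by rewrite -dl; apply/yJ/delta_mem; left.
by apply/eqP; rewrite -oppr_eq0 -dr; apply/eqP/yJ/delta_mem; right.
Qed.

(** By double orthogonality it suffices that whatever is orthogonal to both [perp U] and [perp V]
    lies in [U] and in [V]. *)
Lemma perp_cap_sub U V : (perp (U :&: V) <= perp U + perp V)%VS.
Proof.
rewrite -[X in (_ <= X)%VS]perpK; apply: perpS.
rewrite subv_cap -{2}[U]perpK -{3}[V]perpK.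
by rewrite (perpS (addvSl _ _)) (perpS (addvSr _ _)).
Qed.

(** * The implications between (A), (B) and (E) *)

Section Conditions.
Variables (C D : {vspace vec2 p n}) (I : {set 'I_n}).
Hypotheses (C_isotropic : (C <= perp C)%VS) (D_sub : (D <= C)%VS).

(** Inside [coordsp p I], [perp C] is squeezed between [C] and [perp D], which (E) makes equal. *)
Lemma cap_perp_sub_eq :
  (C :&: coordsp p I)%VS = (perp D :&: coordsp p I)%VS ->
  (C :&: coordsp p I)%VS = (perp C :&: coordsp p I)%VS.
Proof.
move=> E; apply/eqP; rewrite eqEsubv capvS //= E capvS //.
exact: perpS.
Qed.

Lemma cap_perp_sub_decomposition :
  (C :&: coordsp p I)%VS = (perp D :&: coordsp p I)%VS ->
  C = (D + (C :&: coordsp p (~: I)))%VS.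
Proof.
move=> E; apply/eqP; rewrite eqEsubv subv_add D_sub capvSl !andbT.
rewrite -[X in (_ <= X)%VS]perpK -{1}[C]perpK; apply: perpS; apply/subvP => y yW.
have yD : y \in perp D by apply: (subvP (perpS (addvSl _ _))) yW.
have /(subvP (perp_cap_sub _ _)) :
  y \in perp (C :&: coordsp p (~: I)) by apply: (subvP (perpS (addvSr _ _))) yW.
rewrite perp_coordsp setCK => /memv_addP[c cC [e eI ydef]].
(* Both [y] and [c] are in [perp D], the latter because [perp C] is contained in [perp D]; so (E)
   applies to [e]. *)
have eD : e \in perp D.
  rewrite -[e](addKr c) addrC -ydef rpredB //.
  exact: (subvP (perpS D_sub)) cC.
have : e \in (C :&: coordsp p I)%VS by rewrite E memv_cap eD eI.
rewrite memv_cap => /andP[eC _].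
by rewrite ydef rpredD // (subvP C_isotropic).
Qed.

(** By (B), an element of [C] is one of [D] plus one supported off [I]. The latter is orthogonal to
    everything supported on [I], so there [perp D] and [perp C] agree, and (A) concludes. *)
Lemma cap_perp_eq_sub :
  (C :&: coordsp p I)%VS = (perp C :&: coordsp p I)%VS ->
  C = (D + (C :&: coordsp p (~: I)))%VS ->
  (C :&: coordsp p I)%VS = (perp D :&: coordsp p I)%VS.
Proof.
move=> A B; apply/eqP; rewrite eqEsubv {1}A capvS ?perpS //=.
rewrite A; apply/subvP => y; rewrite !memv_cap => /andP[/mem_perp yD yI].
rewrite yI andbT; apply/mem_perp => x; rewrite B => /memv_addP[d dD [c cI ->]].
move: cI; rewrite memv_cap => /andP[_ cI].
rewrite sympC sympDr !(sympC y) yD // (mem_coordsp_perp cI yI).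
by rewrite oppr0 addr0 oppr0.
Qed.

End Conditions.

Lemma eq_syndrome_perp {D l} {xs : l.-tuple (vec2 p n)} {e f} :
  basis_of D xs -> syndrome xs e = syndrome xs f -> e - f \in perp D.
Proof.
move=> xsD ef; apply/mem_perp => x /(coord_basis xsD) ->.
rewrite sympC symp_sumr big1 ?oppr0 // => i _.
have /rowP/(_ i) := ef; rewrite !mxE (tnth_nth 0) => efi.
by rewrite sympC sympDr sympNr efi subrr oppr0 mulr0.
Qed.

End SymplecticDuality.

(** * Unitary matrices and their eigenvalues *)

Section Unitarity.
Variables (R : realType).

(** [U] preserves the squared norm of [v], while scaling by [c] multiplies it by the square of
    [|c|]. *)
Lemma unitary_eigenvalue_norm {m} {U : 'M[R[i]]_m} {v : 'cV[R[i]]_m} {c : R[i]} :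
  U \is unitarymx -> v != 0 -> U *m v = c *: v -> `|c| = 1.
Proof.
move=> Uu v0 Uv.
have Uinv : U ^t* *m U = 1%:M.
  by rewrite -[LHS]mul1mx mulmxA mulmxKtV.
have sq (w : 'cV[R[i]]_m) : (w ^t* *m w) 0 0 = \sum_i `|w i 0| ^+ 2.
  by rewrite mxE; apply: eq_bigr => i _; rewrite !mxE mulrC normCK.
have S0 : \sum_i `|v i 0| ^+ 2 != 0.
  apply: contraNneq v0 => /eqP; rewrite psumr_eq0 => [/allP S|i _]; last first.
    by rewrite exprn_ge0.
  apply/eqP/colP => i; have := S i (mem_index_enum _).
  by rewrite /= expf_eq0 /= normr_eq0 mxE => /eqP.
have : (U *m v) ^t* *m (U *m v) = v ^t* *m v.
  by rewrite trmx_mul map_mxM /= mulmxA -[X in X *m v]mulmxA Uinv mulmx1.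
move/(congr1 (fun M : 'M_1 => M 0 0)); rewrite !sq Uv.
under eq_bigr do rewrite mxE normrM exprMn.
rewrite -mulr_sumr -[RHS]mul1r => /(mulIf S0)/eqP.
by rewrite sqrp_eq1 // => /eqP.
Qed.

Lemma unitarymx1 m : (1%:M : 'M[R[i]]_m) \is unitarymx.
Proof. by apply/unitarymxP; rewrite trmx1 map_mx1 mulmx1. Qed.

Lemma unitarymxX m (U : 'M[R[i]]_m) k : U \is unitarymx -> U ^+ k \is unitarymx.
Proof.
move=> Uu; elim: k => [|k IH]; first exact: unitarymx1.
by rewrite exprS mul_unitarymx.
Qed.

End Unitarity.

(** * Unitarity and multiplication of the errors, and the correction *)

Section ErrorOperators.
Variables (R : realType) (p n : nat).

Lemma tensor_mx1 : tensor_mx (fun _ : 'I_n => 1%:M : 'M[R[i]]_p) = 1%:M.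
Proof.
apply/matrixP => i j; rewrite !mxE.
under eq_bigr do rewrite mxE.
have [->|ij] := eqVneq i j; first by rewrite big1 // => k _; rewrite eqxx.
have /forallPn[k kij] : ~~ [forall k,
    (enum_val i : {ffun 'I_n -> 'I_p}) k == (enum_val j : {ffun 'I_n -> 'I_p}) k].
  by apply: contraNN ij => /eqfunP eij; apply/eqP/enum_val_inj/ffunP.
by rewrite (bigD1 k) //= (negbTE kij) mul0r.
Qed.

Lemma tensor_mx_adj (A : 'I_n -> 'M[R[i]]_p) :
  (tensor_mx A) ^t* = tensor_mx (fun k => (A k) ^t*).
Proof.
apply/matrixP => i j; rewrite !mxE rmorph_prod.
by apply: eq_bigr => k _; rewrite !mxE.
Qed.

Lemma tensor_unitary (A : 'I_n -> 'M[R[i]]_p) :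
  (forall k, A k \is unitarymx) -> tensor_mx A \is unitarymx.
Proof.
move=> Au; apply/unitarymxP; rewrite tensor_mx_adj tensor_mx_mul -tensor_mx1.
by apply: eq_tensor_mx => k; apply/unitarymxP.
Qed.

Hypothesis p_pr : prime p.
Let p_gt0 : (0 < p)%N := prime_gt0 p_pr.

Lemma norm_omega : `|omega R p| = 1.
Proof.
have /eqP := congr1 Num.norm (omegaXp R p_gt0).
by rewrite normrX normr1 pexpr_eq1 // => /eqP.
Qed.

Lemma norm_chi (z : 'F_p) : `|chi R z| = 1.
Proof. by rewrite /chi normrX norm_omega expr1n. Qed.

Lemma pauliXX k : pauliX R p ^+ k =
  \matrix_(j, i) (j == (i + k) %% p :> nat)%N%:R.
Proof.
elim: k => [|k IH].
  by apply/matrixP => j i; rewrite expr0 !mxE addn0 modn_small.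
rewrite exprS IH; apply/matrixP => j i; rewrite !mxE.
pose m : 'I_p := Ordinal (ltn_pmod (i + k) p_gt0).
rewrite (bigD1 m) //= !mxE eqxx mulr1 big1 ?addr0.
  by rewrite -addn1 modnDml addn1 addnS.
by move=> l; rewrite -val_eqE /= => /negPf lm; rewrite !mxE lm mulr0.
Qed.

(** Exponents are representatives of elements of ['F_p]; this absorbs the reduction when two of them
    are added. *)
Lemma pauliX_modexp k : pauliX R p ^+ (k %% p)%N = pauliX R p ^+ k.
Proof. by rewrite !pauliXX; apply/matrixP => j i; rewrite !mxE modnDmr. Qed.

Lemma pauliZX_diag k : pauliZ R p ^+ k = diag_mx (\row_i omega R p ^+ (i * k)%N).
Proof.
elim: k => [|k IH].
  by apply/matrixP => i j; rewrite !mxE muln0.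
rewrite exprS IH -[LHS]/(_ *m _) mulmx_diag; congr diag_mx.
by apply/rowP => i; rewrite !mxE mulnS exprD.
Qed.

Lemma pauliZ_modexp k : pauliZ R p ^+ (k %% p)%N = pauliZ R p ^+ k.
Proof.
rewrite !pauliZX_diag; congr diag_mx; apply/rowP => i; rewrite !mxE.
by rewrite -(omega_mod _ (_ * _)) // modnMmr omega_mod.
Qed.

Lemma pauliX_unitary : pauliX R p \is unitarymx.
Proof.
(* Transposing makes the entries inner products of columns, and column [i] has its single 1 in row
   [i + 1] modulo [p]. *)
rewrite -trmx_unitary; apply/unitarymxP; rewrite trmxK.
apply/matrixP => i j; rewrite !mxE.
pose m : 'I_p := Ordinal (ltn_pmod i.+1 p_gt0).
rewrite (bigD1 m) //= !mxE eqxx mul1r big1 ?addr0 => [|l]; last first.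
  by rewrite -val_eqE /= => /negPf lm; rewrite !mxE lm mul0r.
rewrite rmorph_nat; congr (_%:R); congr nat_of_bool.
by rewrite -[RHS]val_eqE /= -(addn1 i) -(addn1 j) eqn_modDr !modn_small.
Qed.

Lemma pauliZ_unitary : pauliZ R p \is unitarymx.
Proof.
apply/unitarymxP; rewrite tr_diag_mx map_diag_mx mulmx_diag -diag_const_mx.
congr diag_mx; apply/rowP => i; rewrite !mxE.
by rewrite -normCK normrX norm_omega !expr1n.
Qed.

Lemma errM_unitary (x : vec2 p n) : errM R x \is unitarymx.
Proof.
apply: tensor_unitary => k; apply: mul_unitarymx; apply: unitarymxX.
  exact: pauliX_unitary.
exact: pauliZ_unitary.
Qed.

(** Moving the powers of [pauliZ] past those of [pauliX] costs only powers of [omega], which have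
    norm 1. *)
Lemma errM_mul_phase (x y : vec2 p n) :
  exists2 c : R[i], `|c| = 1 & errM R x *m errM R y = c *: errM R (x + y).
Proof.
exists (\prod_k chi R (apart y k * bpart x k)).
  by rewrite normr_prod big1 // => k _; rewrite norm_chi.
rewrite errM_mul //; congr (_ *: _); apply: eq_tensor_mx => k.
have FpD (a b : 'F_p) : (a + b : 'F_p) = ((a + b) %% p)%N :> nat.
  by rewrite -{1}(natr_Zp a) -{1}(natr_Zp b) -natrD val_Fp_nat.
have -> : apart (x + y) k = apart x k + apart y k by rewrite /apart mxE.
have -> : bpart (x + y) k = bpart x k + bpart y k by rewrite /bpart mxE.
by rewrite !FpD pauliX_modexp pauliZ_modexp.
Qed.

Lemma stab_eigenvalue_norm {C : {vspace vec2 p n}} {eta} {phi : qstate R p n} {x} :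
  stab_eigenvector C eta phi -> x \in C -> `|eta (errM R x)| = 1.
Proof.
case=> phi0 eta_phi xC.
apply: (unitary_eigenvalue_norm _ (errM_unitary x) phi0).
exact/eta_phi/stab_gen.
Qed.

Lemma can_correct_of_cap_perp (C D : {vspace vec2 p n}) I eta
    (phi : qstate R p n) :
  stab_eigenvector C eta phi ->
  (C :&: coordsp p I)%VS = (perp D :&: coordsp p I)%VS ->
  can_correct D I (stabilizer_code C eta).
Proof.
move=> eta_phi E l xs xsD s.
pose P (e : vec2 p n) := (e \in coordsp p I) && (syndrome xs e == s).
(* If no error on [I] has syndrome [s], any unitary serves, here the identity; otherwise one such
   error [e0] is undone. *)
have [[e0 /andP[e0I /eqP e0s]]|noe] := pselect (exists e, P e); last first.
  exists 1%:M; split=> [|e eI es]; first exact: unitarymx1.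
  by case: noe; exists e; rewrite /P eI es eqxx.
exists ((errM R e0) ^t*); split; first by rewrite trmxC_unitary errM_unitary.
move=> e eI es psi Qpsi.
have eC : e - e0 \in C.
  have : e - e0 \in (C :&: coordsp p I)%VS.
    rewrite E memv_cap (rpredB eI e0I) andbT.
    by apply: (eq_syndrome_perp _ _ xsD); rewrite es.
  by rewrite memv_cap => /andP[].
have [c c1 Mc] := errM_mul_phase e0 (e - e0).
have c0 : c != 0 by rewrite -normr_eq0 c1 oner_eq0.
(* [c^-1] comes from factoring [errM R e] through [errM R e0]; the eigenvalue comes from
   [errM R (e - e0)] acting on [psi]. *)
exists (c^-1 * eta (errM R (e - e0))).
  by rewrite normrM normfV c1 invr1 mul1r (stab_eigenvalue_norm eta_phi).
rewrite [e0 + _]addrC subrK in Mc.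
have -> : errM R e = c^-1 *: (errM R e0 *m errM R (e - e0)).
  by rewrite Mc scalerA mulVf // scale1r.
rewrite -scalemxAl -scalemxAr -[_ *m _ *m psi]mulmxA (Qpsi _ (stab_gen _ eC)).
rewrite -scalemxAr -scalemxAr scalerA mulmxA.
have /unitarymxP/mulmx1C -> := errM_unitary e0.
by rewrite mul1mx.
Qed.

End ErrorOperators.

Theorem proposition4 (R : realType) (p n : nat) (p_prime : prime p)
    (n_pos : (0 < n)%N)
    (C : {vspace vec2 p n}) (C_isotropic : (C <= perp C)%VS)
    (eta : qop R p n -> R[i]) (phi : qstate R p n)
    (eta_phi : stab_eigenvector C eta phi)
    (I : {set 'I_n}) (D : {vspace vec2 p n}) (D_sub : (D <= C)%VS) :
  let A := (C :&: coordsp p I)%VS = (perp C :&: coordsp p I)%VS in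
  let B := C = (D + (C :&: coordsp p (~: I)))%VS in
  let E := (C :&: coordsp p I)%VS = (perp D :&: coordsp p I)%VS in
  (E -> A /\ B) /\
  (A /\ B -> E) /\
  (A /\ B -> can_correct D I (stabilizer_code C eta)).
Proof.
move=> A B E.
have AB_E : A /\ B -> E by case; exact: cap_perp_eq_sub.
split; last by split=> // /AB_E; exact: can_correct_of_cap_perp eta_phi.
move=> e; split; first exact: cap_perp_sub_eq e.
exact: cap_perp_sub_decomposition e.
Qed.
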